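(* Let $R(m,n)$ denote the number of Rogers--Ramanujan partitions of $n$ with rank $m$. Then, as formal power series (equivalently for $|q|<1$ and $|zq|<1$), \[ \sum_{n=0}^{\infty}\sum_{m=-\infty}^{\infty}R(m,n)\,z^mq^n=\sum_{n=0}^{\infty}\frac{z^{n-1}q^{n^2}}{(zq;q)_n}. \]
   Context: A Rogers--Ramanujan partition of $n$ is a partition of $n$ in which any two parts differ by at least $2$. The (Dyson) rank of a partition is its largest part minus its number of parts; for the empty partition (the only Rogers--Ramanujan partition of $0$), the identity corresponds to the convention that its contribution is $z^{-1}$, i.e. it is assigned rank $-1$. Notation: $(a;q)_0=1$ and $(a;q)_n=(1-a)(1-aq)\cdots(1-aq^{n-1})$ for $n\ge1$. *)

(* Defs.v *)
From HB Require Import structures.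
From mathcomp Require Import all_boot all_order all_algebra.
From mathcomp Require Import boolp classical_sets fsbigop.

Set Implicit Arguments.
Unset Strict Implicit.
Unset Printing Implicit Defensive.

Import Order.TTheory GRing.Theory Num.Theory.
Local Open Scope ring_scope.

(* Formal power series over a commutative ring R, as coefficient sequences. *)
Record fps (R : Type) := Fps { fcoef : nat -> R }.

Notation "{ 'fps' R }" := (fps R) (at level 0, format "{ 'fps'  R }").

HB.instance Definition _ (R : Type) := [isNew for @fcoef R].
HB.instance Definition _ (R : choiceType) := [Choice of {fps R} by <:].

Lemma fpsP (R : Type) (f g : {fps R}) : fcoef f =1 fcoef g -> f = g.
Proof. by case: f g => [f] [g] /= /funext ->. Qed.

Section FpsRing.
Variable R : comUnitRingType.
Implicit Types f g h : {fps R}.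

Definition fps_const (c : R) : {fps R} := Fps (fun k => if k is 0%N then c else 0).
Definition fps_var : {fps R} := Fps (fun k => (k == 1%N)%:R).

Definition fps_add f g : {fps R} := Fps (fun k => fcoef f k + fcoef g k).
Definition fps_opp f : {fps R} := Fps (fun k => - fcoef f k).
Definition fps_mul f g : {fps R} :=
  Fps (fun k => \sum_(i < k.+1) fcoef f i * fcoef g (k - i)).

Lemma fps_addA : associative fps_add.
Proof. by move=> f g h; apply: fpsP => k /=; rewrite addrA. Qed.
Lemma fps_addC : commutative fps_add.
Proof. by move=> f g; apply: fpsP => k /=; rewrite addrC. Qed.
Lemma fps_add0 : left_id (fps_const 0) fps_add.
Proof. by move=> f; apply: fpsP => -[|k] /=; rewrite add0r. Qed.
Lemma fps_addN : left_inverse (fps_const 0) fps_opp fps_add.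
Proof. by move=> f; apply: fpsP => -[|k] /=; rewrite addNr. Qed.

HB.instance Definition _ :=
  GRing.isZmodule.Build {fps R} fps_addA fps_addC fps_add0 fps_addN.

Lemma fps_mulC : commutative fps_mul.
Proof.
move=> f g; apply: fpsP => k /=; rewrite (reindex_inj rev_ord_inj) /=.
by apply: eq_bigr => i _; rewrite subSS subKn ?leq_ord // mulrC.
Qed.

Lemma fps_mulA : associative fps_mul.
Proof.
have rv f g k : fcoef (fps_mul f g) k
    = \sum_(i < k.+1) fcoef f (k - i) * fcoef g i.
  by rewrite fps_mulC /=; apply: eq_bigr => i _; rewrite mulrC.
have fw f g k : fcoef (fps_mul f g) k
    = \sum_(i < k.+1) fcoef f i * fcoef g (k - i) by [].
move=> f g h; apply: fpsP => i; rewrite fw [RHS]rv.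
pose coef3 j k := fcoef f j * (fcoef g (i - j - k) * fcoef h k).
transitivity (\sum_(j < i.+1) \sum_(k < i.+1 | (k <= i - j)%N) coef3 j k).
  apply: eq_bigr => j _; rewrite rv big_distrr /=.
  by rewrite (big_ord_narrow_leq (leq_subr _ _)).
rewrite (exchange_big_dep predT) //; apply: eq_bigr => k _.
transitivity (\sum_(j < i.+1 | (j <= i - k)%N) coef3 j k).
  apply: eq_bigl => j; rewrite -ltnS -(ltnS j) -!subSn ?leq_ord //.
  by rewrite -subn_gt0 -(subn_gt0 j) -!subnDA addnC.
rewrite (big_ord_narrow_leq (leq_subr _ _)) big_distrl.
by apply: eq_bigr => j _; rewrite /coef3 -!subnDA addnC mulrA.
Qed.

Lemma fps_mul1 : left_id (fps_const 1) fps_mul.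
Proof.
move=> f; apply: fpsP => k /=; rewrite big_ord_recl mul1r subn0 big1 ?addr0 //.
by move=> i _; rewrite mul0r.
Qed.

Lemma fps_mulDl : left_distributive fps_mul fps_add.
Proof.
move=> f g h; apply: fpsP => k /=; rewrite -big_split.
by apply: eq_bigr => i _; rewrite mulrDl.
Qed.

Lemma fps_1_neq0 : fps_const 1 != 0 :> {fps R}.
Proof. by apply/eqP => /(congr1 (fun f => fcoef f 0)) /eqP; rewrite oner_eq0. Qed.

HB.instance Definition _ := GRing.Zmodule_isComNzRing.Build {fps R}
  fps_mulA fps_mulC fps_mul1 fps_mulDl fps_1_neq0.

(* The first n coefficients of the inverse of f, obtained by solving
   \sum_(i <= k) g_i f_(k - i) = (k == 0) for g_k. *)
Fixpoint fps_inv_seq f (n : nat) : seq R :=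
  if n is k.+1 then
    let s := fps_inv_seq f k in
    rcons s (((k == 0)%:R - \sum_(i < k) s`_i * fcoef f (k - i)) / fcoef f 0)
  else [::].

Definition fps_unit : {pred {fps R}} := [pred f | fcoef f 0 \is a GRing.unit].

Definition fps_inv f : {fps R} :=
  if f \in fps_unit then Fps (fun k => (fps_inv_seq f k.+1)`_k) else f.

Lemma size_fps_inv_seq f n : size (fps_inv_seq f n) = n.
Proof. by elim: n => //= n IHn; rewrite size_rcons IHn. Qed.

Lemma nth_fps_inv_seq f n i : (i < n)%N ->
  (fps_inv_seq f n)`_i = (fps_inv_seq f i.+1)`_i.
Proof.
elim: n => // n IHn; rewrite ltnS leq_eqVlt => /predU1P[-> //|lt_in].
by rewrite [in LHS]/= nth_rcons size_fps_inv_seq lt_in IHn.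
Qed.

Lemma fps_mulVf : {in fps_unit, left_inverse 1 fps_inv *%R}.
Proof.
move=> f Uf; apply: fpsP => k; rewrite /fps_inv Uf.
have Uf0 : fcoef f 0 \is a GRing.unit := Uf.
transitivity ((k == 0)%:R : R); last by case: k.
rewrite [LHS]/= big_ord_recr /= subnn nth_rcons size_fps_inv_seq ltnn eqxx.
rewrite divrK // addrC -[RHS](subrK (\sum_(i < k)
  (fps_inv_seq f k)`_i * fcoef f (k - i))).
congr (_ + _); apply: eq_bigr => i _.
by rewrite -[rcons _ _]/(fps_inv_seq f i.+1) (nth_fps_inv_seq f (ltn_ord i)).
Qed.

Lemma fps_unitPl f g : g * f = 1 -> fps_unit f.
Proof.
move/(congr1 (fun h => fcoef h 0)); rewrite /= big_ord1 /= => gf1.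
by apply/unitrP; exists (fcoef g 0); rewrite [fcoef f 0 * _]mulrC.
Qed.

Lemma fps_inv_out : {in [predC fps_unit], fps_inv =1 id}.
Proof. by move=> f; rewrite inE /= /fps_inv => /negPf ->. Qed.

HB.instance Definition _ := GRing.ComNzRing_hasMulInverse.Build {fps R}
  fps_mulVf fps_unitPl fps_inv_out.

(* \sum_(n >= 0) u n converges to s coefficientwise, each coefficient of the
   partial sums being eventually constant. *)
Definition fps_sum (u : nat -> {fps R}) (s : {fps R}) : Prop :=
  forall k : nat, exists N : nat, forall M : nat, (N <= M)%N ->
    fcoef (\sum_(n < M) u n) k = fcoef s k.

Lemma fps_sum_unique u s t : fps_sum u s -> fps_sum u t -> s = t.
Proof.
move=> us ut; apply: fpsP => k; have [[M uM] [N uN]] := (us k, ut k).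
by rewrite -(uM _ (leq_maxl M N)) (uN _ (leq_maxr M N)).
Qed.

End FpsRing.

Arguments fps_var {R}.

Definition qpoch (A : comPzRingType) (a q : A) (n : nat) : A :=
  \prod_(i < n) (1 - a * q ^+ i).

Definition is_partition (n : nat) (p : seq nat) : bool :=
  [&& sorted geq p, 0%N \notin p & sumn p == n].

Definition is_RR (p : seq nat) : bool :=
  pairwise (fun a b : nat => (2 <= `|a - b|)%N) p.

(* The empty partition has rank -1 by convention: it contributes z^-1. *)
Definition dyson_rank (p : seq nat) : int :=
  if p is [::] then -1 else (\max_(a <- p) a)%N%:Z - (size p)%:Z.

(* A partition of n has at most n parts, each at most n (partition_bseq below),
   so the partitions of n live in the finite type {bseq n of 'I_n.+1}. *)
Definition RR_count (m : int) (n : nat) : nat :=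
  #|[set s : {bseq n of 'I_n.+1} | let p := [seq val a | a <- s] in
      [&& is_partition n p, is_RR p & dyson_rank p == m]]|.

Lemma partition_bseq (n : nat) (p : seq nat) : is_partition n p ->
  exists s : {bseq n of 'I_n.+1}, [seq val a | a <- s] = p.
Proof.
case/and3P=> _ p_gt0 /eqP <-.
have sz : (size p <= sumn p)%N.
  elim: p p_gt0 => //= a p IHp; rewrite inE negb_or eq_sym -lt0n.
  by case/andP=> a_gt0 /IHp; rewrite -add1n; apply: leq_add.
have le_p : forall a, a \in p -> (a < (sumn p).+1)%N.
  move=> a; rewrite ltnS; elim: p {p_gt0 sz} => //= b p IHp.
  rewrite inE => /predU1P[->|/IHp]; first exact: leq_addr.
  by move/leq_trans; apply; exact: leq_addl.
have sz' : (size [seq inord a : 'I_(sumn p).+1 | a <- p] <= sumn p)%N.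
  by rewrite size_map.
exists (Bseq sz'); rewrite /= -map_comp -[RHS]map_id.
by apply/eq_in_map => a /le_p lt_a; rewrite /= inordK.
Qed.

(* Z[z, z^-1] is a subring of Q(z), the coefficient field of the series in q. *)
Definition ratfun : fieldType := {fraction {poly int}}.
Definition zvar : {fps ratfun} := fps_const (tofrac 'X).
Definition qvar : {fps ratfun} := fps_var.

(* Main.v *)
(* Let F_n(z, q) be the generating function by rank and size of the
   Rogers--Ramanujan partitions with exactly n parts.  If such a partition has
   smallest part at least 2, subtracting 1 from every part lowers the rank by 1
   and the size by n; if its smallest part is 1, removing it and subtracting 2
   from the other parts lowers the rank by 1 and the size by 2n - 1 (for n = 1
   this relies on the empty partition having rank -1).  Hence
   (1 - z q^n) F_n = z q^(2n-1) F_(n-1) with F_0 = z^-1, which gives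
   F_n = z^(n-1) q^(n^2) / (zq; q)_n. *)

From HB Require Import structures.
Require Import Defs.
From mathcomp Require Import all_boot all_order all_algebra.
From mathcomp Require Import boolp classical_sets fsbigop.
From mathcomp Require Import zify.
Import Order.TTheory GRing.Theory Num.Theory.
Local Open Scope ring_scope.

(** * Enumerating Rogers--Ramanujan partitions by size and number of parts *)

Definition gap (a b : nat) : bool := (b.+2 <= a)%N.

(** It filters the same finite type that [RR_count] ranges over; [partition_bseq] ensures that no
    partition is lost. *)
Definition RR_partitions (k : nat) : seq (seq nat) :=
  [seq p <- [seq [seq val a | a <- s] | s : {bseq k of 'I_k.+1}]
     | is_partition k p && is_RR p].

Definition RR_parts (n k : nat) : seq (seq nat) :=
  [seq p <- RR_partitions k | size p == n].

Definition append_one (p : seq nat) : seq nat := rcons [seq a.+2 | a <- p] 1%N.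

(** Decreasing order turns the symmetric distance condition into a one-sided one, which is easier to
    shift and to extend at the end. *)
Lemma sorted_is_RR (p : seq nat) : sorted geq p && is_RR p = pairwise gap p.
Proof.
rewrite sorted_pairwise; last by move=> b a c /= ab bc; exact: leq_trans bc ab.
rewrite /is_RR -pairwise_relI; apply: eq_pairwise => a b.
by rewrite /gap /=; apply/idP/idP; lia.
Qed.

Lemma mem_RR_partitions (k : nat) (p : seq nat) :
  (p \in RR_partitions k) = [&& pairwise gap p, 0%N \notin p & sumn p == k].
Proof.
rewrite mem_filter -sorted_is_RR.
have -> : [&& sorted geq p && is_RR p, 0%N \notin p & sumn p == k]
    = is_partition k p && is_RR p.
  by rewrite /is_partition -andbA [RHS]andbC andbCA.
apply: andb_idr => /andP[/partition_bseq[s <-] _].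
by apply/mapP; exists s => //; rewrite mem_enum.
Qed.

Lemma RR_partitions_uniq (k : nat) : uniq (RR_partitions k).
Proof.
rewrite filter_uniq // map_inj_uniq ?enum_uniq // => s t.
by move/(inj_map val_inj)/val_inj.
Qed.

Lemma RR_parts_uniq (n k : nat) : uniq (RR_parts n k).
Proof. by rewrite filter_uniq // RR_partitions_uniq. Qed.

Lemma mem_RR_parts (n k : nat) (p : seq nat) : (p \in RR_parts n k) =
  [&& pairwise gap p, 0%N \notin p, sumn p == k & size p == n].
Proof. by rewrite mem_filter mem_RR_partitions andbC -!andbA. Qed.

Lemma size_RR_partition (k : nat) (p : seq nat) :
  p \in RR_partitions k -> (size p <= k)%N.
Proof.
rewrite mem_RR_partitions => /and3P[_ + /eqP <-].
elim: p => //= a p IHp; rewrite inE negb_or => /andP[a0 /IHp]; lia.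
Qed.

Lemma RR_parts0 (k : nat) : RR_parts 0 k = if k is 0%N then [:: [::]] else [::].
Proof.
have mem0 p : p \in RR_parts 0 k -> p = [::] /\ k = 0%N.
  by rewrite mem_RR_parts; case: p => [|a p]; rewrite ?andbF //= andbT => /eqP.
case: k mem0 => [|k] mem0; last first.
  by case: RR_parts mem0 => // p s /(_ p); rewrite mem_head => /(_ isT)[].
apply: perm_small_eq => //; apply: uniq_perm; rewrite ?RR_parts_uniq // => p.
by rewrite inE; apply/idP/eqP => [/mem0[]//|->]; rewrite mem_RR_parts.
Qed.

Lemma sumn_map_addn (m : nat) (p : seq nat) :
  sumn [seq (m + a)%N | a <- p] = (sumn p + m * size p)%N.
Proof. by elim: p => [|a p /= ->]; rewrite /= ?muln0 ?mulnS //; lia. Qed.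

(** * Recursive decomposition according to the smallest part *)

Lemma mem_map_succn_RR_parts (n k : nat) (p : seq nat) :
  p \in RR_parts n k -> [seq a.+1 | a <- p] \in RR_parts n (k + n).
Proof.
rewrite !mem_RR_parts => /and4P[gp p0 /eqP <- /eqP <-].
rewrite (sumn_map_addn 1) size_map mul1n !eqxx pairwise_map gp /= andbT.
by apply/mapP => -[].
Qed.

Lemma mem_append_one_RR_parts (n k : nat) (p : seq nat) :
  p \in RR_parts n k -> append_one p \in RR_parts n.+1 (k + n.*2.+1).
Proof.
rewrite !mem_RR_parts => /and4P[gp p0 /eqP <- /eqP <-].
rewrite pairwise_rcons pairwise_map gp mem_rcons inE sumn_rcons.
rewrite (sumn_map_addn 2) size_rcons size_map mul2n addn1 addnS !eqxx !andbT.
apply/andP; split; last by apply/mapP => -[].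
rewrite all_map; apply/allP => a ap; rewrite /= /gap !ltnS lt0n.
by apply: contraNneq p0 => <-.
Qed.

Lemma RR_parts_cases (n k : nat) (p : seq nat) : p \in RR_parts n.+1 k ->
  (exists2 s, [seq a.+1 | a <- s] = p & s \in RR_parts n.+1 (k - n.+1))
   /\ (n < k)%N
  \/ (exists2 s, append_one s = p & s \in RR_parts n (k - n.*2.+1))
   /\ (n.*2 < k)%N.
Proof.
rewrite mem_RR_parts; case/lastP: p => [|p x]; first by rewrite !andbF.
rewrite pairwise_rcons mem_rcons inE negb_or sumn_rcons size_rcons eqSS.
case/and4P=> /andP[/allP gpx gp] /andP[x0 p0] /eqP <- /eqP <-.
(* The last entry [x] is the smallest part: either it is 1, and the other parts are at least 3, or
   every part is at least 2. *)
case: x x0 gpx => [//|[|x]] _ gpx.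
  have Ep : [seq a.+2 | a <- [seq a.-2 | a <- p]] = p.
    rewrite -map_comp -[RHS]map_id; apply/eq_in_map => a /gpx.
    by rewrite /gap /=; lia.
  right; move: gp p0 gpx; rewrite -Ep; set s := [seq _ | _ <- p] => gp p0 gpx.
  rewrite (sumn_map_addn 2) size_map; split; last by lia.
  exists s => //; rewrite mem_RR_parts eqxx.
  move: gp; rewrite pairwise_map => -> /=.
  apply/and3P; split=> //; last by apply/eqP; lia.
  (* A zero in [s] would be a part 2 of the original, too close to its last part 1. *)
  by apply/negP => s0; have := gpx 2%N (map_f _ s0).
have Ep : [seq a.+1 | a <- [seq a.-1 | a <- rcons p x.+2]] = rcons p x.+2.
  rewrite -map_comp -[RHS]map_id; apply/eq_in_map => a.
  by rewrite mem_rcons inE => /predU1P[-> //|/gpx]; rewrite /gap /=; lia.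
left; move: (Ep); set s := [seq _ | _ <- rcons _ _] => Es.
have sz : size s = (size p).+1 by rewrite size_map size_rcons.
have sm : (sumn p + x.+2 = sumn s + (size p).+1)%N.
  by rewrite -sumn_rcons -Es (sumn_map_addn 1) sz; lia.
split; last by lia.
exists s => //; rewrite mem_RR_parts sz eqxx andbT sm addnK eqxx andbT.
have gs : pairwise gap (rcons p x.+2).
  by rewrite pairwise_rcons gp andbT; apply/allP.
move: gs; rewrite -Es pairwise_map => -> /=.
rewrite /s map_rcons mem_rcons inE /=; apply/mapP => -[a /gpx].
by rewrite /gap; lia.
Qed.

(** The guards protect against truncated subtraction: at [n = k = 0] the second list would otherwise
    contain [[:: 1]], which is not a partition of 0. *)
Lemma perm_RR_partsS (n k : nat) :
  perm_eq (RR_parts n.+1 k)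
    ((if (n < k)%N then [seq [seq a.+1 | a <- p] | p <- RR_parts n.+1 (k - n.+1)]
      else [::])
     ++ (if (n.*2 < k)%N then [seq append_one p | p <- RR_parts n (k - n.*2.+1)]
         else [::])).
Proof.
have inj_succ : injective (map succn) by apply: inj_map => a b [].
have inj_app : injective append_one.
  by move=> p s /rcons_inj[/(inj_map _) Eps]; apply: Eps => a b [].
apply: uniq_perm; first exact: RR_parts_uniq.
  rewrite cat_uniq; apply/and3P; split.
  - by case: ifP => // _; rewrite map_inj_uniq ?RR_parts_uniq.
  - case: (n.*2 < k)%N => //; apply/hasPn => _ /mapP[p _ ->].
    case: (n < k)%N => //; apply/mapP => -[s].
    (* The two lists are disjoint: a part 1 in a shifted partition would come from a part 0. *)
    rewrite mem_RR_parts => /and4P[_ s0 _ _] E; case/negP: s0.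
    have : 1%N \in append_one p by rewrite mem_rcons mem_head.
    by rewrite E => /mapP[a sa [->]].
  - by case: ifP => // _; rewrite map_inj_uniq ?RR_parts_uniq.
move=> p; rewrite mem_cat; apply/idP/orP.
  case/RR_parts_cases=> -[[s <- sP] ->]; [left | right]; exact: map_f.
case; case: ifP => // lt_nk /mapP[s sP ->].
  by have := mem_map_succn_RR_parts _ _ _ sP; rewrite subnK.
by have := mem_append_one_RR_parts _ _ _ sP; rewrite subnK.
Qed.

(** * Effect of the two operations on the rank *)

Lemma dyson_rank_cons (a : nat) (p : seq nat) : pairwise gap (a :: p) ->
  dyson_rank (a :: p) = a%:Z - (size p).+1%:Z.
Proof.
case/andP=> /allP ga _; rewrite /dyson_rank big_cons (maxn_idPl _) //.
by apply/bigmax_leqP_seq => b /ga; rewrite /gap; lia.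
Qed.

(** At least one part is required: shifting the empty partition leaves its rank at -1. *)
Lemma dyson_rank_map_succn (n k : nat) (p : seq nat) : p \in RR_parts n.+1 k ->
  dyson_rank [seq a.+1 | a <- p] = dyson_rank p + 1.
Proof.
rewrite mem_RR_parts => /and4P[gp _ _]; case: p gp => // a p gp _.
rewrite [LHS]dyson_rank_cons -/(map _ (a :: p)) ?pairwise_map //.
by rewrite dyson_rank_cons // size_map; lia.
Qed.

Lemma dyson_rank_append_one (n k : nat) (p : seq nat) : p \in RR_parts n k ->
  dyson_rank (append_one p) = dyson_rank p + 1.
Proof.
move=> pP; have := mem_append_one_RR_parts _ _ _ pP.
move: pP; rewrite !mem_RR_parts => /and4P[gp _ _ _] /and4P[gp' _ _ _].
(* The convention is used here: [[:: 1]] has rank 0, one more than the rank -1 of the empty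
   partition. *)
case: p gp gp' => [|a p] gp gp'; first by rewrite /dyson_rank big_seq1.
rewrite [LHS]dyson_rank_cons // dyson_rank_cons // size_rcons size_map; lia.
Qed.

(** * Coefficients of formal power series *)

Section FpsCoef.
Variable R : comUnitRingType.
Implicit Types f g : {fps R}.

Lemma fps_const_is_zmod_morphism : zmod_morphism (@fps_const R).
Proof. by move=> a b; apply: fpsP => -[|k] //=; rewrite subr0. Qed.

Lemma coef_fps_constM (c : R) f k : fcoef (fps_const c * f) k = c * fcoef f k.
Proof.
rewrite [LHS]/= big_ord_recl subn0 big1 ?addr0 // => i _.
by rewrite mul0r.
Qed.

Lemma fps_const_is_monoid_morphism : monoid_morphism (@fps_const R).
Proof.
split=> // a b; apply: fpsP => k; rewrite coef_fps_constM.
by case: k => //= k; rewrite mulr0.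
Qed.

HB.instance Definition _ :=
  GRing.isZmodMorphism.Build R {fps R} (@fps_const R) fps_const_is_zmod_morphism.
HB.instance Definition _ :=
  GRing.isMonoidMorphism.Build R {fps R} (@fps_const R) fps_const_is_monoid_morphism.

Lemma coef_fps_varM f k :
  fcoef (fps_var * f) k = if k is k'.+1 then fcoef f k' else 0.
Proof.
case: k => [|k]; rewrite [LHS]/= big_ord_recl mul0r add0r ?big_ord0 //.
rewrite big_ord_recl mul1r subSS subn0 big1 ?addr0 // => i _.
by rewrite mul0r.
Qed.

Lemma coef_fps_varXM j f k :
  fcoef (fps_var ^+ j * f) k = if (j <= k)%N then fcoef f (k - j) else 0.
Proof.
elim: j k => [|j IHj] k; first by rewrite mul1r subn0.
by rewrite exprS -mulrA coef_fps_varM; case: k => [|k] //; rewrite IHj.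
Qed.

Lemma coef_fps_varX j k : fcoef (fps_var ^+ j : {fps R}) k = (k == j)%:R.
Proof.
rewrite -[_ ^+ _]mulr1 coef_fps_varXM; case: ltngtP => // [lt_jk|->].
  by case: (k - j)%N (subn_gt0 j k) => //; rewrite lt_jk.
by rewrite subnn.
Qed.

Lemma coef_fpsD f g k : fcoef (f + g) k = fcoef f k + fcoef g k.
Proof. by []. Qed.

Lemma coef_fps_sum (I : Type) (r : seq I) (P : pred I) (F : I -> {fps R}) k :
  fcoef (\sum_(i <- r | P i) F i) k = \sum_(i <- r | P i) fcoef (F i) k.
Proof.
by rewrite (big_morph (fun f => fcoef f k) (id1 := 0) (op1 := +%R)) //; case: k.
Qed.

Lemma fps_unitE f : (f \is a GRing.unit) = (fcoef f 0 \is a GRing.unit).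
Proof. by []. Qed.

End FpsCoef.

(** * Generating functions for a fixed number of parts *)

Lemma tofracX_neq0 : tofrac 'X != 0 :> ratfun.
Proof. by rewrite tofrac_eq0 polyX_eq0. Qed.

Lemma zvar_unit : zvar \is a GRing.unit.
Proof. by rewrite fps_unitE unitfE tofracX_neq0. Qed.

Lemma zvarXz (m : int) : zvar ^ m = fps_const (tofrac 'X ^ m).
Proof. by rewrite rmorphXz // unitfE tofracX_neq0. Qed.

Definition rank_coef (n k : nat) : ratfun :=
  \sum_(p <- RR_parts n k) tofrac 'X ^ dyson_rank p.

Definition rank_series (n : nat) : {fps ratfun} := Fps (rank_coef n).

Lemma rank_coefS (n k : nat) : rank_coef n.+1 k =
  (if (n < k)%N then tofrac 'X * rank_coef n.+1 (k - n.+1) else 0)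
  + (if (n.*2 < k)%N then tofrac 'X * rank_coef n (k - n.*2.+1) else 0).
Proof.
rewrite /rank_coef (perm_big _ (perm_RR_partsS n k)) big_cat /=.
congr (_ + _); case: ifP => _; rewrite ?big_nil // big_map big_distrr /=.
  apply: eq_big_seq => p /dyson_rank_map_succn ->.
  by rewrite addrC exprzDr ?unitfE ?tofracX_neq0.
apply: eq_big_seq => p /dyson_rank_append_one ->.
by rewrite addrC exprzDr ?unitfE ?tofracX_neq0.
Qed.

Lemma rank_series0 : rank_series 0 = zvar ^ (-1).
Proof.
rewrite zvarXz; apply: fpsP => k; rewrite /= /rank_coef RR_parts0.
by case: k => [|k]; rewrite ?big_nil // big_seq1.
Qed.

(** Multiplying by [qvar ^+ j] shifts coefficients by [j] and puts 0 below, which accounts for the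
    guards in [rank_coefS]. *)
Lemma rank_seriesS (n : nat) : rank_series n.+1 =
  zvar * qvar * qvar ^+ n * rank_series n.+1
  + zvar * qvar ^+ n.*2.+1 * rank_series n.
Proof.
apply: fpsP => k; rewrite [LHS]rank_coefS -(mulrA zvar qvar) -exprS.
rewrite -!(mulrA zvar) coef_fpsD !coef_fps_constM !coef_fps_varXM.
by congr (_ + _); case: ifP; rewrite ?mulr0.
Qed.

Lemma one_sub_zq_unit (n : nat) : 1 - zvar * qvar * qvar ^+ n \is a GRing.unit.
Proof.
rewrite fps_unitE.
have -> : fcoef (1 - zvar * qvar * qvar ^+ n) 0 = 1 :> ratfun.
  rewrite -mulrA -exprS -mulrN coef_fpsD coef_fps_constM.
  by rewrite -[fcoef (- _) 0]/(- fcoef _ 0) coef_fps_varX oppr0 mulr0 addr0.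
exact: unitr1.
Qed.

(** The induction step as plain ring algebra: [f] and [g] are consecutive series, [x] is the old
    denominator and [y] its new factor. *)
Lemma quotient_step (A : comUnitRingType) (f g z a b c x y : A) :
  x \is a GRing.unit -> y \is a GRing.unit ->
  g * y = z * b * f -> f = a * c / x -> g = z * a * (b * c) / (x * y).
Proof.
move=> Ux Uy gy fE; rewrite -[LHS](mulrK Uy) gy fE invrM //.
by rewrite [y^-1 / x]mulrC !mulrA [z * b * a]mulrAC.
Qed.

Lemma rank_seriesE (n : nat) : rank_series n =
  zvar ^ (n%:Z - 1) * qvar ^+ (n ^ 2) / qpoch (zvar * qvar) qvar n.
Proof.
elim: n => [|n IHn].
  by rewrite rank_series0 /qpoch big_ord0 divr1 expr0 mulr1.
have Un := one_sub_zq_unit n.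
have Uq : qpoch (zvar * qvar) qvar n \is a GRing.unit.
  by apply: rpred_prod => i _; exact: one_sub_zq_unit.
have rec : rank_series n.+1 * (1 - zvar * qvar * qvar ^+ n)
    = zvar * qvar ^+ n.*2.+1 * rank_series n.
  by rewrite mulrBr mulr1 [X in _ - X]mulrC {1}rank_seriesS addrAC subrr add0r.
have qS : qpoch (zvar * qvar) qvar n.+1
    = qpoch (zvar * qvar) qvar n * (1 - zvar * qvar * qvar ^+ n).
  by rewrite /qpoch big_ord_recr.
have -> : n.+1%:Z - 1 = 1 + (n%:Z - 1) by lia.
have -> : (n.+1 ^ 2 = n.*2.+1 + n ^ 2)%N by lia.
rewrite qS (exprzDr zvar_unit 1 (n%:Z - 1)) (expr1z zvar) (exprD qvar).
exact: (quotient_step _ _ _ _ _ _ _ _ _ Uq Un rec IHn).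
Qed.

(** * Summing over ranks and over numbers of parts *)

Lemma RR_countE (m : int) (k : nat) :
  RR_count m k = count (fun p => dyson_rank p == m) (RR_partitions k).
Proof.
rewrite count_filter count_map count_filter /RR_count cardsE cardE /enum_mem.
rewrite size_filter -enumT.
by apply: eq_count => s; rewrite /= unfold_in /= andbT [RHS]andbC -andbA.
Qed.

Lemma sum_RR_count (k : nat) :
  \sum_(m \in [set: int]%classic) (RR_count m k)%:R * zvar ^ m * qvar ^+ k
  = fps_const (\sum_(p <- RR_partitions k) tofrac 'X ^ dyson_rank p) * qvar ^+ k.
Proof.
(* Only the finitely many ranks that occur contribute to the sum over all integers. *)
rewrite (fsbigE (undup (map dyson_rank (RR_partitions k)))) ?undup_uniq //; last first.
  move=> m _; rewrite mem_undup RR_countE => /count_memPn.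
  by rewrite count_map => ->; rewrite !mul0r.
under eq_bigl do rewrite in_setT.
rewrite -big_distrl /=; congr (_ * _).
rewrite rmorph_sum /=; under [RHS]eq_bigr do rewrite -zvarXz.
rewrite -[RHS](big_map dyson_rank predT (fun m => zvar ^ m)).
(* Partitions of equal rank are grouped, so each power of [zvar] gets its multiplicity. *)
rewrite -[RHS]big_undup_iterop_count; apply: eq_bigr => m _.
by rewrite mulr_natl RR_countE count_map.
Qed.

(** A partition of [k] has at most [k] parts, so each one is counted for exactly one [n < M]. *)
Lemma sum_rank_coef (k M : nat) : (k < M)%N ->
  \sum_(n < M) rank_coef n k
    = \sum_(p <- RR_partitions k) tofrac 'X ^ dyson_rank p.
Proof.
move=> lt_kM; under eq_bigr do rewrite /rank_coef big_filter.
rewrite (exchange_big_dep predT) //=; apply: eq_big_seq => p pk.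
have lt_pM : (size p < M)%N := leq_ltn_trans (size_RR_partition _ _ pk) lt_kM.
by rewrite (big_pred1 (Ordinal lt_pM)) // => n; rewrite eq_sym.
Qed.

Theorem theorem1p1 :
  exists S : {fps ratfun},
    fps_sum (fun n : nat => \sum_(m \in [set: int]%classic)
               (RR_count m n)%:R * zvar ^ m * qvar ^+ n) S
    /\ fps_sum (fun n : nat =>
               zvar ^ (n%:Z - 1) * qvar ^+ (n ^ 2) / qpoch (zvar * qvar) qvar n) S.
Proof.
exists (Fps (fun k => \sum_(p <- RR_partitions k) tofrac 'X ^ dyson_rank p)).
(* From [k.+1] terms on, the coefficient of [q^k] is constant: on the left only the term [n = k]
   reaches it, on the right [sum_rank_coef] applies. *)
split=> k; exists k.+1 => M lt_kM; rewrite coef_fps_sum.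
  under eq_bigr do rewrite sum_RR_count coef_fps_constM coef_fps_varX.
  rewrite (bigD1 (Ordinal lt_kM)) //= eqxx mulr1 [X in _ + X]big1 ?addr0 // => n neq_nk.
  by rewrite (_ : (k == n) = false) ?mulr0 //; apply: contraNF neq_nk; rewrite eq_sym.
rewrite -[RHS](sum_rank_coef _ _ lt_kM).
by apply: eq_bigr => n _; rewrite -rank_seriesE.
Qed.
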